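(* Let $\sigma>0$ and $\alpha>0$. The matrix $$\Gamma_{\mathrm m}^{\mathrm{crit}}=\begin{pmatrix}\frac{9\sigma^2}{16}&\frac{9\sigma^3}{32}\\[2pt] \frac{9\sigma^3}{32}&\frac{3\sigma^4}{16}\end{pmatrix}$$ is positive definite, and so is the $2\times2$ upper-left block of $$\Gamma_{\mathrm o}^{\mathrm{crit}}=\begin{pmatrix}\frac{9\sigma^2}{16}&\frac{9\sigma^3}{32}&0\\[2pt] \frac{9\sigma^3}{32}&\frac{3\sigma^4}{16}&0\\[2pt] 0&0&\frac1{2\alpha}\end{pmatrix}.$$
   Context: These are the critical covariance matrices (at Hurst index $H=3/4$) of the mixed fractional Brownian motion and mixed fractional Ornstein--Uhlenbeck models with parameters $\sigma$ (scale of the fractional component) and $\alpha$ (drift). *)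

(* Defs.v *)
From mathcomp Require Import all_boot all_order all_algebra.
From mathcomp Require Import reals.

Set Implicit Arguments.
Unset Strict Implicit.
Unset Printing Implicit Defensive.

Import Order.TTheory GRing.Theory Num.Theory.
Local Open Scope ring_scope.

Definition posdefmx (R : realType) (n : nat) (A : 'M[R]_n) : Prop :=
  A \is symmetricmx /\
  forall x : 'cV[R]_n, x != 0 -> 0 < (x^T *m A *m x) 0 0.

Definition mx_of_rows (R : realType) (m n : nat) (rows : seq (seq R)) :
    'M[R]_(m, n) :=
  \matrix_(i < m, j < n) nth 0 (nth [::] rows i) j.

Definition Gamma_m_crit (R : realType) (sigma : R) : 'M[R]_2 :=
  mx_of_rows 2 2
    [:: [:: 9 * sigma ^+ 2 / 16; 9 * sigma ^+ 3 / 32];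
        [:: 9 * sigma ^+ 3 / 32; 3 * sigma ^+ 4 / 16]].

(* The dimension is written 2 + 1 so that the upper-left 2 x 2 block is
   ulsubmx. *)
Definition Gamma_o_crit (R : realType) (sigma alpha : R) : 'M[R]_(2 + 1) :=
  mx_of_rows (2 + 1) (2 + 1)
    [:: [:: 9 * sigma ^+ 2 / 16; 9 * sigma ^+ 3 / 32; 0];
        [:: 9 * sigma ^+ 3 / 32; 3 * sigma ^+ 4 / 16; 0];
        [:: 0; 0; 1 / (2 * alpha)]].

(* Main.v *)
Require Import Defs.
From mathcomp Require Import all_boot all_order all_algebra.
From mathcomp Require Import reals.
From mathcomp Require Import ring.

(** Both matrices reduce to a single one: the upper-left block of the
    Ornstein-Uhlenbeck covariance does not involve [alpha] and coincides with
    [Gamma_m_crit sigma].  For a symmetric 2 x 2 matrix, positive definiteness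
    follows from Sylvester's criterion ([posdefmx_Sylvester2]): the two leading
    minors are positive.  Here they are [9 sigma^2 / 16] and
    [(108 - 81) / 1024 * sigma^6 = 27 sigma^6 / 1024]. *)

Set Implicit Arguments.
Unset Strict Implicit.
Unset Printing Implicit Defensive.

Import Order.TTheory GRing.Theory Num.Theory.
Local Open Scope ring_scope.

Lemma ord2P (i : 'I_2) : {i = 0} + {i = 1}.
Proof. by case: i => -[|[|//]] ?; [left | right]; apply: val_inj. Qed.

Lemma big_ord2 (R : nmodType) (F : 'I_2 -> R) : \sum_i F i = F 0 + F 1.
Proof. by rewrite big_ord_recl big_ord1; congr (_ + F _); apply: val_inj. Qed.

Lemma det_mx2 (R : comPzRingType) (A : 'M[R]_2) :
  \det A = A 0 0 * A 1 1 - A 0 1 * A 1 0.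
Proof.
rewrite (expand_det_row _ 0) big_ord2 /cofactor !det_mx11 !mxE /=.
have -> : lift 0 0 = 1 :> 'I_2 by apply: val_inj.
have -> : lift 1 0 = 0 :> 'I_2 by apply: val_inj.
by rewrite expr0 expr1 mul1r mulN1r mulrN.
Qed.

(** Completing the square: with [a] the top-left entry, [b] the off-diagonal one
    and [x = (u, v)], [a * (x^T A x) = (a u + b v)^2 + \det A * v^2].  Both terms
    are nonnegative, and they vanish together only if [v = 0] and then
    [u = 0]. *)
Lemma posdefmx_Sylvester2 (R : realType) (A : 'M[R]_2) :
  A 0 1 = A 1 0 -> 0 < A 0 0 -> 0 < \det A -> posdefmx A.
Proof.
move=> Asym a_gt0 detA_gt0; split.
  apply/is_hermitianmxP; rewrite expr0 scale1r; apply/matrixP => i j.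
  rewrite !mxE /=.
  by case: (ord2P i) => ->; case: (ord2P j) => ->.
move=> x x_neq0; rewrite -(pmulr_rgt0 _ a_gt0).
have -> : A 0 0 * (x^T *m A *m x) 0 0 =
    (A 0 0 * x 0 0 + A 0 1 * x 1 0) ^+ 2 + \det A * x 1 0 ^+ 2.
  by rewrite det_mx2 !mxE !big_ord2 !mxE !big_ord2 !mxE Asym; ring.
have [v0|v_neq0] := eqVneq (x 1 0) 0; last first.
  by rewrite ltr_wpDl ?sqr_ge0 // mulr_gt0 // exprn_even_gt0.
rewrite v0 expr0n !mulr0 !addr0 exprn_even_gt0 //= mulf_neq0 ?(gt_eqF a_gt0) //.
apply: contraNneq x_neq0 => u0; apply/eqP/matrixP => i j.
by rewrite ord1 mxE; case: (ord2P i) => ->.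
Qed.

Lemma Gamma_m_crit_posdef (R : realType) (sigma : R) :
  0 < sigma -> posdefmx (Gamma_m_crit sigma).
Proof.
move=> s_gt0; apply: posdefmx_Sylvester2; rewrite ?det_mx2 !mxE //=.
  by rewrite divr_gt0 ?mulr_gt0 ?exprn_gt0.
have -> : 9 * sigma ^+ 2 / 16 * (3 * sigma ^+ 4 / 16) -
  9 * sigma ^+ 3 / 32 * (9 * sigma ^+ 3 / 32) = 27 / 1024 * sigma ^+ 6.
  by field.
by rewrite mulr_gt0 ?divr_gt0 ?exprn_gt0.
Qed.

Lemma ulsubmx_Gamma_o_crit (R : realType) (sigma alpha : R) :
  ulsubmx (Gamma_o_crit sigma alpha) = Gamma_m_crit sigma.
Proof. by apply/matrixP => -[[|[|//]] ?] [[|[|//]] ?]; rewrite !mxE. Qed.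

Theorem corollary2 (R : realType) (sigma alpha : R)
    (sigma_gt0 : 0 < sigma) (alpha_gt0 : 0 < alpha) :
  posdefmx (Gamma_m_crit sigma) /\
  posdefmx (ulsubmx (Gamma_o_crit sigma alpha)).
Proof.
rewrite ulsubmx_Gamma_o_crit.
by split; apply: Gamma_m_crit_posdef.
Qed.
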